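(* Let $a, b \in \mathbb{N}$ with $1 \leq a < b$ and $\gcd(a,b) = 1$, let $\theta = a/b$, and set $$C_{\theta} = \frac{1}{b-a} \sum_{i=1}^{\lfloor b/a \rfloor} \frac{1}{i}.$$ (1) Let $w = w(n)$ be a positive real-valued function with $w(n) = o(n^{1/3})$ as $n \to \infty$. If, for each $n$, $\mathcal{F}_n$ is a $w(n)$-bounded $\theta$-intersecting family over $[n]$, then $|\mathcal{F}_n| \leq (C_{\theta} + o(1)) n$ as $n \to \infty$. (2) The constant $C_\theta$ is best possible for $\theta \in \{1/3\} \cup [1/2, 1)$: for each such rational $\theta = a/b$, there exist a positive function $w(n) = o(n^{1/3})$ and, for each $n$, a $w(n)$-bounded $\theta$-intersecting family $\mathcal{F}_n$ over $[n]$ with $|\mathcal{F}_n| \geq (C_{\theta} - o(1)) n$ as $n \to \infty$. (3) Let $w(n)=o(n^{1/3})$ and $(\mathcal{F}_n)$ be as in (1), and suppose that (asymptotic) equality holds, i.e. $|\mathcal{F}_n| = (C_{\theta} + o(1)) n$ as $n\to\infty$. Then for each $n$ there is a bouquet $\mathcal{F}_n^{*} \subseteq \mathcal{F}_n$ such that $|\mathcal{F}_n \setminus \mathcal{F}_n^{*}| = o(n)$, and all but $o(n)$ elements $x \in [n]$ have the property that for every integer $i$ with $1 \leq i \leq \lfloor b/a \rfloor$, $x$ is contained in some set of $\mathcal{F}_n^{*}$ of size $ib$.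
   Context: Write $[n] = \{1,\dots,n\}$. A family over $[n]$ is a set of (distinct) subsets of $[n]$. For $\theta \in (0,1)\cap\mathbb{Q}$, a (fractional) $\theta$-intersecting family over $[n]$ is a collection $\mathcal{F}$ of nonempty subsets of $[n]$ such that for all $A, B \in \mathcal{F}$ with $A \neq B$ we have $|A \cap B| \in \{\theta |A|, \theta |B|\}$. For a positive real $w$, a family of sets is $w$-bounded if every set in the family has size at most $w$. A sunflower is a set family $\mathcal{F}$ in which all pairwise intersections are the same: for all distinct $F, F' \in \mathcal{F}$, $F \cap F' = \bigcap_{F'' \in \mathcal{F}} F''$. The set $C = \bigcap_{F'' \in \mathcal{F}} F''$ is its core, and the pairwise disjoint sets $F \setminus C$, $F \in \mathcal{F}$, are its petals. For a family $\mathcal{F}$ and an integer $k$, $\mathcal{F}(k)$ denotes the collection of all sets in $\mathcal{F}$ of size $k$. Let $\mathcal{F}$ be a family over $[n]$ and let $k_1 < \dots < k_t$ be the sizes of the sets in $\mathcal{F}$. Then $\mathcal{F}$ is a bouquet if: (i) each $\mathcal{F}(k_j)$ is a sunflower with at least two petals (i.e. with at least two members); (ii) $C_{k_1} \subsetneq C_{k_2} \subsetneq \dots \subsetneq C_{k_t}$, where $C_{k_j}$ denotes the core of $\mathcal{F}(k_j)$; (iii) for every $F \in \mathcal{F}$ we have $F \cap C_{k_t} = C_{|F|}$. *)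

(* Defs.v *)
From mathcomp Require Import all_boot all_order all_algebra.
Set Implicit Arguments.
Unset Strict Implicit.
Unset Printing Implicit Defensive.
Import Order.TTheory GRing.Theory Num.Theory.
Local Open Scope ring_scope.

(* The ground set [n] = {1, ..., n} is represented by 'I_n. *)

Definition intersecting (theta : rat) n (F : {set {set 'I_n}}) : Prop :=
  (forall A, A \in F -> A != set0) /\
  (forall A B, A \in F -> B \in F -> A != B ->
     #|A :&: B|%:R = theta * #|A|%:R \/ #|A :&: B|%:R = theta * #|B|%:R).

Definition bounded_by (R : numDomainType) (w : R) n (F : {set {set 'I_n}}) :
  Prop := forall A, A \in F -> #|A|%:R <= w.

Definition core n (F : {set {set 'I_n}}) : {set 'I_n} := \bigcap_(A in F) A.

Definition sunflower n (F : {set {set 'I_n}}) : Prop :=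
  forall A B, A \in F -> B \in F -> A != B -> A :&: B = core F.

Definition level n (F : {set {set 'I_n}}) (k : nat) : {set {set 'I_n}} :=
  [set A in F | #|A| == k].

Definition sizes n (F : {set {set 'I_n}}) : seq nat :=
  sort leq (undup [seq #|A| | A : {set 'I_n} in F]).

(* The empty family (t = 0) is a bouquet: all three conditions are void. *)
Definition bouquet n (F : {set {set 'I_n}}) : Prop :=
  [/\ forall k, k \in sizes F ->
        sunflower (level F k) /\ (2 <= #|level F k|)%N,
      sorted (fun k l => core (level F k) \proper core (level F l)) (sizes F)
    & forall A, A \in F ->
        A :&: core (level F (last 0%N (sizes F))) = core (level F #|A|)].

Definition Ctheta (R : numFieldType) (a b : nat) : R :=
  (b%:R - a%:R)^-1 * \sum_(1 <= i < (b %/ a).+1) i%:R^-1.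

(* Main.v *)
Require Import Defs.
From mathcomp Require Import all_boot all_order all_algebra.
From mathcomp Require Import zify ring lra.
Set Implicit Arguments.
Unset Strict Implicit.
Unset Printing Implicit Defensive.
Import Order.TTheory GRing.Theory Num.Theory.

(** All but one set have size divisible by [b]. The sets of size [k] pairwise
    meet in [theta k] points, so by Deza's theorem they form a sunflower as soon
    as there are more than [2 k^2 + 1] of them; the remaining sizes contribute
    [O(w^3) = o(n)] sets. Large sunflowers have petals avoiding any given small
    set, which forces their cores into a chain and, after deleting at most one
    set per size, yields a bouquet.

    In a bouquet let each petal of a set of size [i b] spread weight [1/i] over
    each of its [i (b - a)] points, for a total of [(b - a) |F|]. The indices
    [i] of the petals through a fixed point lie in a window [m, m b / a], so the
    point receives at most the harmonic number of [floor (b / a)], with a uniform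
    loss unless the indices are exactly [1, ..., floor (b / a)]. This gives both
    the bound and the structure in the case of equality.

    The extremal families put disjoint copies of a finite pattern of petals next
    to a fixed core; for [theta = 1/3] the pattern lives on a 6 x 4 grid, with
    columns, rows, and pairs inside columns as petals. *)

(** * Deza's theorem for uniform families with constant intersection size *)

(* Nonnegativity of the squared norm of the combination of the indicators of the
   sets through x (coefficient e) and off x (coefficient -d), compared with its
   square de at x. *)
Lemma deza_degree (T : finType) (G : {set {set T}}) (l m : nat) (x : T) :
  (forall A, A \in G -> #|A| = l + m) ->
  (forall A B, A \in G -> B \in G -> A != B -> #|A :&: B| = l) ->
  #|[set A in G | x \in A]| * #|[set A in G | x \notin A]| <= m * #|G|.
Proof.
move=> cardG capG; set d := #|_|; set e := #|_|.
have GE : #|G| = d + e.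
  rewrite -(cardsID [set A : {set T} | x \in A] G); congr (_ + _).
    by apply: eq_card => A; rewrite !inE.
  by apply: eq_card => A; rewrite !inE andbC.
case: (posnP (d * e)) => [-> //|de0].
pose c (A : {set T}) : int := (if x \in A then e%:R else - d%:R)%R.
pose v y := (\sum_(A in G) c A * (y \in A)%:R)%R.
have splitG (g : {set T} -> int) : (\sum_(A in G) g A =
    \sum_(A in [set A in G | x \in A]) g A + \sum_(A in [set A in G | x \notin A]) g A)%R.
  rewrite (bigID (fun A : {set T} => x \in A)) /=.
  by congr (_ + _)%R; apply: eq_bigl => A; rewrite !inE.
have sumc : (\sum_(A in G) c A = 0)%R.
  rewrite splitG (eq_bigr (fun=> e%:R)%R) => [|A]; last first.
    by rewrite inE /c => /andP[_ ->].
  rewrite [X in (_ + X)%R](eq_bigr (fun=> - d%:R)%R) => [|A]; last first.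
    by rewrite inE /c => /andP[_ /negPf ->].
  rewrite !sumr_const -/d -/e -(mulr_natl (e%:R)%R) -(mulr_natl (- d%:R)%R).
  by ring.
have sumc2 : (\sum_(A in G) c A ^+ 2 = (d * e * (d + e))%:R)%R.
  rewrite splitG (eq_bigr (fun=> e%:R ^+ 2)%R) => [|A]; last first.
    by rewrite inE /c => /andP[_ ->].
  rewrite [X in (_ + X)%R](eq_bigr (fun=> d%:R ^+ 2)%R) => [|A]; last first.
    by rewrite inE /c => /andP[_ /negPf ->]; rewrite sqrrN.
  rewrite !sumr_const -/d -/e -(mulr_natl (e%:R ^+ 2)%R) -(mulr_natl (d%:R ^+ 2)%R).
  by rewrite !natrM natrD; ring.
have vx : v x = (d * e)%:R%R.
  rewrite /v splitG (eq_bigr (fun=> e%:R)%R) => [|A]; last first.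
    by rewrite inE /c => /andP[_ ->]; rewrite mulr1.
  rewrite [X in (_ + X)%R]big1 => [|A]; last first.
    by rewrite inE /c => /andP[_ /negPf ->]; rewrite mulr0.
  by rewrite addr0 sumr_const -/d -(mulr_natl (e%:R)%R) natrM.
have normv : (\sum_y v y ^+ 2 = m%:R * (d * e * (d + e))%:R)%R.
  transitivity (\sum_(A in G) \sum_(B in G) c A * c B * #|A :&: B|%:R)%R.
    under eq_bigr => y _.
      rewrite expr2 /v big_distrlr /=; over.
    rewrite exchange_big; apply: eq_bigr => A _ /=.
    rewrite exchange_big; apply: eq_bigr => B _ /=.
    rewrite -sum1_card natr_sum mulr_sumr [RHS]big_mkcond /=.
    apply: eq_bigr => y _; rewrite inE.
    by case: (y \in A); case: (y \in B); rewrite /= ?mulr0 ?mul0r ?mulr1.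
  transitivity (\sum_(A in G) (c A * l%:R * \sum_(B in G) c B + m%:R * c A ^+ 2))%R.
    apply: eq_bigr => A AG; rewrite mulr_sumr (bigD1 A) //= [in RHS](bigD1 A) //=.
    rewrite setIid cardG // natrD addrAC; congr (_ + _)%R; first by ring.
    by apply: eq_bigr => B /andP[BG BA]; rewrite capG // 1?eq_sym //; ring.
  under eq_bigr => A _ do rewrite sumc mulr0 add0r.
  by rewrite -mulr_sumr sumc2.
have : (v x ^+ 2 <= \sum_y v y ^+ 2)%R.
  by rewrite (bigD1 x) //= lerDl sumr_ge0 // => y _; exact: sqr_ge0.
rewrite vx normv -natrX -natrM ler_nat GE => le.
by rewrite -(leq_pmul2l de0) [leqRHS]mulnCA mulnn.
Qed.

(** With [m = k - l], [deza_degree] shows that each point lies in at most [2 * m] sets or is missed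
    by at most [2 * m] of them. The points of the second kind form [D]: every set contains at least
    [l] of them, while [l + 1] of them would lie together in two sets. Hence [D] has [l] points and
    is contained in every set. *)
Lemma deza (T : finType) (G : {set {set T}}) (k l : nat) :
  l < k ->
  (forall A, A \in G -> #|A| = k) ->
  (forall A B, A \in G -> B \in G -> A != B -> #|A :&: B| = l) ->
  2 * k * k + 1 < #|G| ->
  exists2 D : {set T}, #|D| = l &
    forall A B, A \in G -> B \in G -> A != B -> A :&: B = D.
Proof.
move=> lk cardG capG N2; have [m m0 kE] : exists2 m, 0 < m & k = l + m by exists (k - l); lia.
pose d x := #|[set A in G | x \in A]|; pose e x := #|[set A in G | x \notin A]|.
have deN x : d x + e x = #|G|.
  rewrite -(cardsID [set A : {set T} | x \in A] G); congr (_ + _).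
    by apply: eq_card => A; rewrite !inE.
  by apply: eq_card => A; rewrite !inE andbC.
have de x : d x <= 2 * m \/ e x <= 2 * m.
  have := deza_degree x (fun A AG => etrans (cardG A AG) kE) capG.
  rewrite -/(d x) -/(e x) -(deN x).
  by case: (leqP (d x) (e x)) => ?; [left|right]; nia.
pose D := [set x | e x <= 2 * m].
have DA A : A \in G -> l <= #|D :&: A|.
  move=> AG; rewrite leqNgt; apply/negP => DAl.
  (* Incidences with [A], counted by sets, number [k + l * (#|G| - 1)]; with fewer than [l] points
     of [D] in [A], counting by points gives at most [2 * m * k + (l - 1) * #|G|], which is too
     small. *)
  have : \sum_(x in A) d x = \sum_(B in G) #|A :&: B|.
    under eq_bigr do rewrite /d -sum1_card.
    under [RHS]eq_bigr do rewrite -sum1_card.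
    rewrite (exchange_big_dep (mem G)) /=; last by move=> i j _; rewrite inE => /andP[].
    by apply: eq_bigr => B BG; apply: eq_bigl => x; rewrite !inE BG.
  rewrite (bigD1 A) //= setIid cardG // [X in _ = _ + X](eq_bigr (fun=> l)); last first.
    by move=> B /andP[BG BA]; rewrite capG // eq_sym.
  rewrite [X in _ = _ + X](eq_bigl (mem (G :\ A))) => [|B]; last by rewrite !inE andbC.
  rewrite sum_nat_const => sumE.
  have cG : #|G| = 1 + #|G :\ A| by rewrite (cardsD1 A G) AG.
  have : \sum_(x in A) d x <= \sum_(x in A) (2 * m + (x \in D) * #|G|).
    apply: leq_sum => x _; rewrite inE.
    have := de x; have := deN x; move: (d x) (e x) => u v.
    by case: (leqP v (2 * m)) => ? <- [] ?; rewrite ?mul1n ?mul0n; lia.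
  rewrite big_split /= sum_nat_const cardG // -big_distrl /=.
  have -> : \sum_(x in A) (x \in D) = #|D :&: A|.
    rewrite -sum1_card big_mkcond [RHS]big_mkcond; apply: eq_bigr => x _.
    by rewrite in_setI; case: (x \in A); case: (x \in D).
  rewrite sumE; move: #|D :&: A| DAl => c cl; rewrite cG; nia.
have sub2 (S : {set T}) : S \subset D -> #|S| <= l.
  move=> SD; rewrite leqNgt; apply/negP => Sl.
  have [S' S'S cS'] : exists2 S' : {set T}, S' \subset S & #|S'| = l.+1.
    exists [set x in take l.+1 (enum S)].
      by apply/subsetP => x; rewrite inE => /mem_take; rewrite mem_enum.
    rewrite cardsE; have /card_uniqP -> : uniq (take l.+1 (enum S)).
      by rewrite take_uniq ?enum_uniq.
    by rewrite size_takel // -cardE.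
  (* At most [(l + 1) * (2 * m) <= 2 * k * k] sets miss a point of [S'], so the bound on [#|G|]
     leaves two sets containing [S']. *)
  have lt1 : 1 < #|[set A in G | S' \subset A]|.
    have : #|[set A in G | ~~ (S' \subset A)]| <= \sum_(x in S') e x.
      have -> : \sum_(x in S') e x = \sum_(B in G) #|S' :\: B|.
        under eq_bigr do rewrite /e -sum1_card.
        under [RHS]eq_bigr do rewrite -sum1_card.
        rewrite (exchange_big_dep (mem G)) /=; last by move=> i j _; rewrite inE => /andP[].
        by apply: eq_bigr => B BG; apply: eq_bigl => x; rewrite !inE BG /= andbC.
      rewrite -sum1_card big_mkcond [leqRHS]big_mkcond /=; apply: leq_sum => B _.
      rewrite inE; case: (B \in G) => //=; case: (boolP (S' \subset B)) => //=.
      by rewrite card_gt0 setD_eq0.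
    have : \sum_(x in S') e x <= \sum_(x in S') 2 * m.
      by apply: leq_sum => x xS; have := subsetP SD _ (subsetP S'S _ xS); rewrite inE.
    rewrite sum_nat_const cS'.
    have : #|G| = #|[set A in G | S' \subset A]| + #|[set A in G | ~~ (S' \subset A)]|.
      rewrite -(cardsID [set A : {set T} | S' \subset A] G); congr (_ + _).
        by apply: eq_card => A; rewrite !inE.
      by apply: eq_card => A; rewrite !inE andbC.
    by nia.
  have /card_gt1P[A [B []]] := lt1; rewrite !inE => /andP[AG SA] /andP[BG SB] AB.
  have := capG _ _ AG BG AB.
  have : S' \subset A :&: B by rewrite subsetI SA.
  by move/subset_leq_card; rewrite cS'; lia.
have cD : #|D| <= l by exact: sub2.
have DsubA A : A \in G -> D \subset A.
  move=> AG; have : D :&: A == D.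
    by rewrite eqEcard subsetIl (leq_trans cD) ?DA.
  by move/eqP/setIidPl.
have [A0 A0G] : exists A, A \in G.
  by apply/set0Pn; rewrite -card_gt0; lia.
have cDl : #|D| = l.
  apply/eqP; rewrite eqn_leq cD (leq_trans (DA _ A0G)) //.
  by apply/subset_leq_card/subsetIl.
exists D => // A B AG BG AB; apply/esym/eqP.
by rewrite eqEcard subsetI !DsubA // capG // cDl leqnn.
Qed.

(** * Petals and cores of sunflowers *)

(** Petals are pairwise disjoint: if [S] met all of them, choosing a point of [S] in each would
    inject [G] into [S]. *)
Lemma sunflower_avoid (T : finType) (G : {set {set T}}) (D S : {set T}) :
  (forall A B, A \in G -> B \in G -> A != B -> A :&: B = D) ->
  #|S| < #|G| -> exists2 A, A \in G & A :&: S \subset D.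
Proof.
move=> GD SG; case: (boolP [exists A in G, A :&: S \subset D]).
  by case/exists_inP => A ? ?; exists A.
rewrite negb_exists_in => /forall_inP nsub.
have pt A : A \in G -> exists x, x \in (A :&: S) :\: D.
  by move=> /nsub AS; apply/set0Pn; rewrite setD_eq0.
have [G0|[A0 A0G]] := set_0Vmem G; first by move: SG; rewrite G0 cards0.
have [x0 _] := pt _ A0G.
pose f A := odflt x0 [pick x in (A :&: S) :\: D].
have fP A : A \in G -> f A \in (A :&: S) :\: D.
  by move=> AG; rewrite /f; case: pickP => // no; have [x] := pt _ AG; rewrite no.
suff : #|G| <= #|S| by lia.
rewrite -(card_in_imset (f := f) (D := mem G)).
  apply/subset_leq_card/subsetP => x /imsetP[A /fP + ->].
  by rewrite !inE => /and3P[].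
move=> A B AG BG fAB; apply/eqP; apply/negPn/negP => AB.
have := fP _ AG; have := fP _ BG; rewrite -fAB !inE => /and3P[_ fB _] /and3P[nD fA _].
by case/negP: nD; rewrite -(GD A B) // inE fA.
Qed.

Lemma core_eq n (G : {set {set 'I_n}}) (D : {set 'I_n}) :
  (forall A B, A \in G -> B \in G -> A != B -> A :&: B = D) ->
  1 < #|G| -> core G = D.
Proof.
move=> GD /card_gt1P[A [B [AG BG AB]]]; apply/eqP; rewrite eqEsubset.
apply/andP; split.
  by rewrite -(GD A B) // subsetI !bigcap_inf.
apply/bigcapsP => E EG; case: (eqVneq E A) => [->|EA].
  by rewrite -(GD A B) // subsetIl.
by rewrite -(GD E A) // subsetIl.
Qed.

(** * Extraction of a bouquet from an intersecting family *)

(** Clearing the denominator of [a / b] keeps the combinatorics in [nat]. *)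
Definition nat_intersecting (a b n : nat) (F : {set {set 'I_n}}) : Prop :=
  set0 \notin F /\ forall A B, A \in F -> B \in F -> A != B ->
    b * #|A :&: B| = a * #|A| \/ b * #|A :&: B| = a * #|B|.

(* The threshold is that of deza, uniformly over the set sizes k <= W. *)
Definition large (b W n : nat) (F : {set {set 'I_n}}) (k : nat) : bool :=
  (b %| k) && (2 * W * W + 1 < #|level F k|).

(** For sets of equal size [k = i * b] the two alternatives coincide and fix the intersection size
    at [a * i], so [deza] applies. *)
Lemma large_core (a b W n : nat) (F : {set {set 'I_n}}) (k : nat) :
  a < b -> nat_intersecting a b F -> (forall A, A \in F -> #|A| <= W) ->
  large b W F k ->
  [/\ 0 < k <= W, W < #|level F k|,
      forall A B, A \in level F k -> B \in level F k -> A != B ->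
        A :&: B = core (level F k),
      #|core (level F k)| < k
    & b * #|core (level F k)| = a * k].
Proof.
move=> ab [F0 FI] FW /andP[/dvdnP[i kE] cL].
have [A AL] : exists A, A \in level F k by apply/set0Pn; rewrite -card_gt0; lia.
have cA B : B \in level F k -> #|B| = k by rewrite inE => /andP[_ /eqP].
have LF B : B \in level F k -> B \in F by rewrite inE => /andP[].
have k0 : 0 < k.
  rewrite -(cA _ AL) card_gt0; apply: contraNneq F0 => <-; exact: LF.
have kW : k <= W by rewrite -(cA _ AL) FW ?LF.
have lk : a * i < k by rewrite kE mulnC ltn_mul2l ab andbT; lia.
have [A1 B1 A1L B1L A1B1||D cD LD] := deza lk cA.
- have := FI _ _ (LF _ A1L) (LF _ B1L) A1B1.
  by rewrite (cA _ A1L) (cA _ B1L) kE => H; nia.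
- by apply: leq_ltn_trans cL; rewrite leq_add2r leq_mul // leq_mul2l kW orbT.
have cE : core (level F k) = D by apply: core_eq => //; lia.
split; rewrite ?cE ?cD ?k0 //; last by rewrite kE; ring.
by apply: leq_ltn_trans cL; clear; nia.
Qed.

(** Choose [A] of size [k] whose petal avoids the larger core, then [B] of size [l] whose petal
    avoids [A]. They meet exactly in the intersection of the two cores, which must have the size of
    one of the cores, hence is the whole smaller core. *)
Lemma core_chain (a b W n : nat) (F : {set {set 'I_n}}) (k l : nat) :
  0 < a -> a < b -> nat_intersecting a b F -> (forall A, A \in F -> #|A| <= W) ->
  large b W F k -> large b W F l -> k < l ->
  core (level F k) \proper core (level F l).
Proof.
move=> a0 ab FI FW kL lL kl.
have [/andP[k0 kW] kN kD ck kc] := large_core ab FI FW kL.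
have [/andP[l0 lW] lN lD cl lc] := large_core ab FI FW lL.
have [|A AL AD] := sunflower_avoid (S := core (level F l)) kD; first by lia.
have /andP[AF /eqP cA] : (A \in F) && (#|A| == k) by move: AL; rewrite inE.
have [|B BL BD] := sunflower_avoid (S := A) lD; first by rewrite ?cA; lia.
have /andP[BF /eqP cB] : (B \in F) && (#|B| == l) by move: BL; rewrite inE.
have sk : core (level F k) \subset A by apply: bigcap_inf.
have sl : core (level F l) \subset B by apply: bigcap_inf.
have AB : A != B by apply: contraTneq kl => AB; rewrite -cA AB cB ltnn.
have ABE : A :&: B = core (level F k) :&: core (level F l).
  apply/eqP; rewrite eqEsubset subsetI setISS // andbT.
  have ABl : A :&: B \subset core (level F l) by rewrite setIC.
  by rewrite ABl andbT (subset_trans _ AD) // subsetI subsetIl.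
have := FI.2 _ _ AF BF AB; rewrite ABE cA cB -kc -lc => cAB.
have cI : #|core (level F k) :&: core (level F l)| <= #|core (level F k)|.
  by apply/subset_leq_card/subsetIl.
have ckl : #|core (level F k)| < #|core (level F l)| by nia.
rewrite properEcard ckl andbT.
suff /eqP <- : core (level F k) :&: core (level F l) == core (level F k).
  exact: subsetIr.
rewrite eqEcard subsetIl /=.
by case: cAB => /eqP; rewrite eqn_pmul2l ?(leq_trans _ ab) // => /eqP ->;
  rewrite ?leqnn // ltnW.
Qed.

(** Against a [B] of size [l] whose petal avoids [A], the intersection is the trace of [A] on the
    larger core. The trace contains the core of level [#|A|]; if strictly, only the size of the
    larger core remains possible for it. *)
Lemma core_trace (a b W n : nat) (F : {set {set 'I_n}}) (A : {set 'I_n}) (l : nat) :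
  0 < a -> a < b -> nat_intersecting a b F -> (forall A, A \in F -> #|A| <= W) ->
  A \in F -> large b W F #|A| -> large b W F l -> #|A| < l ->
  A :&: core (level F l) != core (level F #|A|) -> core (level F l) \subset A.
Proof.
move=> a0 ab FI FW AF kL lL kl ne.
have [/andP[k0 kW] kN kD ck kc] := large_core ab FI FW kL.
have [/andP[l0 lW] lN lD cl lc] := large_core ab FI FW lL.
have [|B BL BD] := sunflower_avoid (S := A) lD; first by rewrite ?cA; lia.
have /andP[BF /eqP cB] : (B \in F) && (#|B| == l) by move: BL; rewrite inE.
have AB : A != B by apply: contraTneq kl => AB; rewrite -cB AB ltnn.
have sl : core (level F l) \subset B by apply: bigcap_inf.
have ABE : A :&: B = A :&: core (level F l).
  apply/eqP; rewrite eqEsubset subsetI setIS // andbT.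
  by rewrite subsetIl setIC.
have := FI.2 _ _ AF BF AB; rewrite ABE cB -kc -lc => cAB.
have sk : core (level F #|A|) \subset A :&: core (level F l).
  rewrite subsetI (proper_sub (core_chain a0 ab FI FW kL lL kl)) andbT.
  by apply: bigcap_inf; rewrite inE AF /=.
have : core (level F #|A|) \proper A :&: core (level F l).
  by rewrite properEneq sk andbT eq_sym.
move/proper_card => pc; have : A :&: core (level F l) == core (level F l).
  rewrite eqEcard subsetIr /=.
  case: cAB => /eqP; rewrite eqn_pmul2l ?(leq_trans _ ab) // => /eqP xE.
    by move: pc; rewrite xE ltnn.
  by rewrite xE.
by move/eqP/setIidPr.
Qed.

Lemma last_sorted_max (s : seq nat) (m : nat) :
  sorted leq s -> m \in s -> (forall x, x \in s -> x <= m) -> last 0 s = m.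
Proof.
case/lastP: s => [//|s x] so ms max; rewrite last_rcons.
have xm : x <= m by apply: max; rewrite mem_rcons mem_head.
move: ms; rewrite mem_rcons inE => /orP[/eqP -> //|ms].
apply/eqP; rewrite eqn_leq xm /=.
move: so; rewrite (sorted_pairwise leq_trans) -cats1 pairwise_cat.
by case/and3P=> /allrelP /(_ _ _ ms (mem_head _ _)).
Qed.

(** Kept are the sets of large size with the right trace on the largest core. Discarded are at most
    one set of size not divisible by [b] and, for each size up to [W], either one set of a large
    level or a whole level of at most [2 * W * W + 1] sets. *)
Lemma bouquet_extraction (a b W n : nat) (F : {set {set 'I_n}}) :
  0 < a -> a < b -> coprime a b ->
  nat_intersecting a b F -> (forall A, A \in F -> #|A| <= W) ->
  exists Fs : {set {set 'I_n}},
    [/\ bouquet Fs, Fs \subset F,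
        forall A, A \in Fs -> [/\ 0 < #|A|, b %| #|A|,
          b * #|core (level Fs #|A|)| = a * #|A| & core (level Fs #|A|) \subset A],
        forall A B, A \in Fs -> B \in Fs -> #|A| <= #|B| ->
          core (level Fs #|A|) \subset core (level Fs #|B|)
      & #|F :\: Fs| <= 1 + W.+1 * (2 * W * W + 1)].
Proof.
move=> a0 ab co FI FW.
pose C k := core (level F k).
(* Without large sizes this maximum is 0, and [Fs] is empty. *)
pose top := \max_(k < W.+1 | large b W F k) k.
pose Fs := [set A in F | large b W F #|A| && (A :&: C top == C #|A|)].
have FsF A : A \in Fs -> A \in F by rewrite inE => /andP[].
have FsL A : A \in Fs -> large b W F #|A| by rewrite inE => /and3P[].
have topP k : large b W F k -> large b W F top /\ k <= top.
  move=> kL; have [/andP[_ kW] _ _ _ _] := large_core ab FI FW kL.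
  have kW1 : k < W.+1 by [].
  split; last exact: (leq_bigmax_cond (P := fun j : 'I_W.+1 => large b W F j)
    (F := @nat_of_ord _) (Ordinal kW1) kL).
  have [|j jL jE] := @eq_bigmax_cond _ [pred j : 'I_W.+1 | large b W F j] (@nat_of_ord _).
    by apply/card_gt0P; exists (Ordinal kW1).
  by rewrite (_ : top = j) //; exact: jE.
have lvF k A : A \in level F k -> A \in F by rewrite inE => /andP[].
have lvc k A : A \in level F k -> #|A| = k by rewrite inE => /andP[_ /eqP].
(* A discarded set of a large level contains [C top] by [core_trace]. Two of them would meet in
   [C k], which would then contain the strictly larger [C top]. *)
have bad1 k : large b W F k -> #|level F k :\: level Fs k| <= 1.
  move=> kL; have [tL kt] := topP _ kL.
  have [_ _ kD ck kc] := large_core ab FI FW kL.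
  have ex A : A \in level F k :\: level Fs k -> A \in level F k /\ C top \subset A /\ k < top.
    rewrite in_setD => /andP[nA AL]; have cA := lvc _ _ AL.
    have ne : A :&: C top != C #|A|.
      by apply: contra nA => eqC; rewrite !inE (lvF _ _ AL) cA kL -cA eqC eqxx.
    have kt' : k < top.
      rewrite ltn_neqAle kt andbT; apply: contraNneq ne => kE; rewrite cA kE.
      apply/eqP/setIidPr; apply: bigcap_inf; by rewrite -kE.
    split=> //; split=> //.
    by apply: (core_trace a0 ab FI FW) ne; rewrite ?cA ?(lvF _ _ AL).
  apply/card_le1_eqP => A B /ex[AL [tA kt']] /ex[BL [tB _]].
  apply/eqP/negPn/negP => BA.
  have BAE : B :&: A = C k by apply: kD; rewrite // eq_sym.
  have : C top \subset C k by rewrite -BAE subsetI tB tA.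
  apply/negP; apply: proper_subn; exact: (core_chain a0 ab FI FW).
have lvsub k : level Fs k \subset level F k.
  by apply/subsetP => A; rewrite !inE => /andP[/andP[-> _] ->].
have lvFs k A B : large b W F k -> A \in level Fs k -> B \in level Fs k ->
    A != B -> A :&: B = C k.
  move=> kL /(subsetP (lvsub _)) AL /(subsetP (lvsub _)) BL.
  by have [_ _ kD _ _] := large_core ab FI FW kL; exact: kD.
(* Losing at most one set leaves two, so the core of the level does not change. *)
have lv2 k : large b W F k -> 1 < #|level Fs k|.
  move=> kL; have := bad1 _ kL; have [/andP[k0 kW] kN _ _ _] := large_core ab FI FW kL.
  rewrite cardsD (setIidPr (lvsub k)).
  have /andP[_] := kL; nia.
have coreE k : large b W F k -> core (level Fs k) = C k.
  by move=> kL; apply: core_eq (lv2 _ kL) => A B; exact: lvFs.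
have sizesP k : (k \in sizes Fs) = large b W F k.
  rewrite mem_sort mem_undup; apply/imageP/idP => [[A AF ->]|kL]; first exact: FsL.
  have /card_gt1P[A [_ [+ _ _]]] := lv2 _ kL.
  by rewrite inE => /andP[AF /eqP cA]; exists A.
have sL : sorted leq (sizes Fs) by apply: sort_sorted; exact: leq_total.
have chain k l : large b W F k -> large b W F l -> k < l -> C k \proper C l.
  exact: (core_chain a0 ab FI FW).
exists Fs; split.
- split=> [k|| A AFs].
  + rewrite sizesP => kL; split; last exact: lv2.
    by move=> A B AL BL AB; rewrite coreE // (lvFs k).
  + apply: (@sub_in_sorted _ (mem (sizes Fs)) ltn); last first.
    * by rewrite ltn_sorted_uniq_leq sL sort_uniq undup_uniq.
    * exact/allP.
    by move=> k l /=; rewrite !sizesP => kL lL kl; rewrite !coreE // chain.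
  + have AL := FsL _ AFs; have [tL _] := topP _ AL.
    rewrite (@last_sorted_max _ top) ?sizesP // => [|x]; last by rewrite sizesP => /topP[].
    by rewrite !coreE //; move: AFs; rewrite inE => /and3P[_ _ /eqP].
- by apply/subsetP.
- move=> A AFs; have AL := FsL _ AFs; rewrite coreE //.
  have [/andP[k0 _] _ _ _ kc] := large_core ab FI FW AL.
  have /andP[bA _] := AL; split=> //.
  by apply: bigcap_inf; rewrite inE FsF /=.
- move=> A B AFs BFs; rewrite !coreE ?FsL // leq_eqVlt => /orP[/eqP -> //|AB].
  by apply: proper_sub; apply: chain; rewrite ?FsL.
(* By coprimality, [b] dividing [a * #|A|] forces [b] to divide [#|A|], so two sets of sizes not
   divisible by [b] cannot coexist. *)
rewrite -(cardsID [set A : {set 'I_n} | ~~ (b %| #|A|)]) leq_add //.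
  apply/card_le1_eqP => A B; rewrite !inE => /andP[/andP[_ AF] nA] /andP[/andP[_ BF] nB].
  apply/eqP/negPn/negP => BA; have := FI.2 _ _ BF AF BA.
  have co' : coprime b a by rewrite coprime_sym.
  by case=> E; [move: nB|move: nA]; rewrite -(Gauss_dvdr _ co') -E dvdn_mulr.
set R := _ :\: _.
have -> : R = \bigcup_(k < W.+1) level R k.
  apply/setP => A; apply/idP/bigcupP => [AR|[k _]]; last by rewrite inE => /andP[].
  have AW : #|A| < W.+1 by rewrite ltnS FW //; move: AR; rewrite !inE => /and3P[].
  by exists (Ordinal AW); rewrite // inE AR /=.
apply: leq_trans (_ : \sum_(k < W.+1) #|level R k| <= _).
  elim/big_rec2: _ => [|k x y _ H]; first by rewrite cards0.
  by apply: leq_trans (leq_card_setU _ _) _; rewrite leq_add2l.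
rewrite -[X in X * _]card_ord -sum_nat_const; apply: leq_sum => k _.
have RF : level R k \subset level F k :\: level Fs k.
  apply/subsetP => A /setIdP[/setDP[/setDP[AF AFs] _] cA].
  rewrite in_setD; apply/andP; split; last exact/setIdP.
  by apply: contra AFs => /setIdP[].
case: (boolP (large b W F k)) => [kL|].
  by apply: leq_trans (subset_leq_card RF) _; apply: leq_trans (bad1 _ kL) _; rewrite addn1.
rewrite /large negb_and -leqNgt => /orP[nb|]; last first.
  apply: leq_trans; apply: subset_leq_card; apply: subset_trans RF _; exact: subsetDl.
rewrite (_ : level R k = set0) ?cards0 //.
apply/setP => A; rewrite !inE; apply/negP => /andP[/and3P[bA _ _] /eqP cA].
by move: bA; rewrite cA (negPf nb).
Qed.

(** * Extremal families built from periodic templates *)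

Lemma card_ord_seq (n : nat) (L : seq nat) : uniq L -> all (ltn^~ n) L ->
  #|[set x : 'I_n | val x \in L]| = size L.
Proof.
move=> uL /allP Ln; rewrite cardE -(size_map val); apply/perm_size/uniq_perm => //.
  by rewrite map_inj_uniq ?enum_uniq //; exact: val_inj.
move=> i; apply/mapP/idP => [[x + ->]|iL]; first by rewrite mem_enum inE.
by exists (Ordinal (Ln _ iL)); rewrite // mem_enum inE.
Qed.

Lemma count_ltn_iota (k l : nat) : count (ltn^~ l) (iota 0 k) = minn k l.
Proof.
elim: k => [|k IH]; first by rewrite min0n.
by rewrite -addn1 iotaD count_cat IH /= add0n addn0; case: ltnP; lia.
Qed.

(* A template describes sets {0, .., k-1} U (c + u s + p), one for each pair
   (k, p) of the template and each block u of length s above the core [0, c). *)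
Definition meets_ok (a b : nat) (P Q : nat * seq nat) (x : nat) : bool :=
  (b * (minn P.1 Q.1 + x) == a * (P.1 + size P.2)) ||
  (b * (minn P.1 Q.1 + x) == a * (Q.1 + size Q.2)).

Definition template_ok (a b c s : nat) (t : seq (nat * seq nat)) : bool :=
  [&& all (fun P => [&& P.1 <= c, uniq P.2, all (ltn^~ s) P.2 & 0 < P.1]) t,
      all (fun P => all (fun Q => meets_ok a b P Q 0) t) t
    & let idx := iota 0 (size t) in let P := nth (0, [::]) t in
      all (fun i => all (fun j => (i == j) ||
        meets_ok a b (P i) (P j) (count (mem (P j).2) (P i).2)) idx) idx].

(** Core parts are initial segments, so two of them meet in the shorter one. Petals in different
    blocks are disjoint, which is the second test of [template_ok]; petals in the same block overlap
    as their offsets do, which is the third. *)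
Lemma template_family (a b c s n : nat) (t : seq (nat * seq nat)) :
  a < b -> template_ok a b c s t ->
  exists F : {set {set 'I_n}}, [/\ nat_intersecting a b F,
    forall A, A \in F -> #|A| <= c + s & #|F| = (n - c) %/ s * size t].
Proof.
move=> ab /and3P[/allP tP /allP tX /allP tI].
set m := _ %/ s; pose T := ('I_m * 'I_(size t))%type.
pose P (j : T) := nth (0, [::]) t j.2.
have PP j : [/\ (P j).1 <= c, uniq (P j).2, all (ltn^~ s) (P j).2 & 0 < (P j).1].
  by apply/and4P/tP/mem_nth.
pose L (j : T) := iota 0 (P j).1 ++ [seq c + j.1 * s + y | y <- (P j).2].
have shift_inj u : injective (fun y => c + u * s + y) by move=> x y; lia.
have uL j : uniq (L j).
  have [Pc uP _ _] := PP j.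
  rewrite cat_uniq iota_uniq map_inj_uniq // uP andbT /=.
  by apply/hasPn => x /mapP[y _ ->]; rewrite mem_iota; lia.
have Ln j : all (ltn^~ n) (L j).
  have [Pc _ /allP Ps P0] := PP j; have := ltn_ord j.1.
  have := leq_divM (n - c) s; rewrite -/m => ms um.
  have cn : c + m * s <= n.
    case: (leqP c n) => [|nc]; first by lia.
    by move: (leq_trans (ltn0Sn _) um); rewrite /m (_ : n - c = 0) ?div0n //; lia.
  apply/allP => x; rewrite mem_cat mem_iota => /orP[/=|/mapP[y /Ps ys ->]] /=; first by lia.
  move: ys => /= ys; have : j.1.+1 * s <= m * s by rewrite leq_mul2r um orbT.
  by rewrite mulSn; lia.
pose S (j : T) := [set x : 'I_n | val x \in L j].
have cS j : #|S j| = (P j).1 + size (P j).2.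
  by rewrite card_ord_seq // size_cat size_iota size_map.
have SI i j : #|S i :&: S j| =
    minn (P i).1 (P j).1 + (i.1 == j.1) * count (mem (P j).2) (P i).2.
  have -> : S i :&: S j = [set x : 'I_n | val x \in [seq y <- L i | y \in L j]].
    by apply/setP => x; rewrite !inE mem_filter andbC.
  rewrite card_ord_seq ?filter_uniq //; last first.
    by apply/allP => x; rewrite mem_filter => /andP[_ /(allP (Ln i))].
  have [Pci uPi /allP Psi _] := PP i; have [Pcj uPj /allP Psj _] := PP j.
  rewrite size_filter count_cat count_map; congr (_ + _).
    rewrite -count_ltn_iota; apply: eq_in_count => x; rewrite mem_iota /= => xi.
    rewrite mem_cat mem_iota /= add0n; case: (ltnP x (P j).1) => //= _.
    by apply/negbTE/negP => /mapP[y _]; lia.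
  have -> : (i.1 == j.1) * count (mem (P j).2) (P i).2 =
      count (fun y => (i.1 == j.1) && (y \in (P j).2)) (P i).2.
    by case: (i.1 == j.1); rewrite ?mul1n // mul0n count_pred0.
  apply: eq_in_count => y /Psi /= ys; rewrite mem_cat mem_iota /=.
  rewrite (_ : _ < _ = false) /=; last by lia.
  apply/mapP/andP => [[y' /[dup] yj' /Psj /= ys' E]|[/eqP -> yj]]; last by exists y.
  (* Offsets are below [s], so Euclidean division recovers block and offset. *)
  have E' : i.1 * s + y = j.1 * s + y' by lia.
  have [Eu Ey] : i.1 = j.1 :> nat /\ y = y'.
    have := congr1 (divn^~ s) E'; have := congr1 (modn^~ s) E'.
    by rewrite !modnMDl !modn_small // !divnMDl ?divn_small ?addn0 //; lia.
  by split; [apply/eqP/val_inj | rewrite Ey].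
have Smeet i j : i != j -> b * #|S i :&: S j| = a * #|S i| \/ b * #|S i :&: S j| = a * #|S j|.
  move=> ij; rewrite !cS SI; case: (eqVneq i.1 j.1) => [E|_]; last first.
    have := allP (tX _ (mem_nth (0, [::]) (ltn_ord i.2))) _ (mem_nth (0, [::]) (ltn_ord j.2)).
    by rewrite mul0n => /orP[/eqP|/eqP]; [left|right].
  have ij2 : i.2 != j.2 :> nat.
    by apply: contra ij => /eqP E2;
      rewrite [i]surjective_pairing [j]surjective_pairing E (val_inj E2).
  have := tI i.2; rewrite mem_iota ltn_ord => /(_ isT) /allP /(_ j.2).
  rewrite mem_iota ltn_ord (negPf ij2) mul1n => /(_ isT) /=.
  by move=> /orP[/eqP|/eqP]; [left|right].
have S0 j : 0 < #|S j| by rewrite cS; have [_ _ _ ?] := PP j; lia.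
(* Distinct indices with the same set would give [b * #|S j| = a * #|S j|], impossible for a
   nonempty set as [a < b]. *)
have Sinj : injective S.
  move=> i j E; apply/eqP/negPn/negP => ij.
  by have := Smeet _ _ ij; rewrite -E setIid; have := S0 i; nia.
exists [set S j | j : T]; split; first split.
- by apply/imsetP => -[j _ E]; have := S0 j; rewrite -E cards0.
- move=> A B /imsetP[i _ ->] /imsetP[j _ ->] ij; apply: Smeet.
  by apply: contra ij => /eqP ->.
- move=> A /imsetP[j _ ->]; rewrite cS; have [Pc uP /allP Ps _] := PP j.
  rewrite leq_add // -(size_iota 0 s) uniq_leq_size // => x /Ps /= xs.
  by rewrite mem_iota.
by rewrite card_imset // card_prod !card_ord.
Qed.

Lemma extremal_families (R : realFieldType) (a b : nat) :
  0 < a -> a < b -> coprime a b -> b = 3 * a \/ b <= 2 * a ->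
  exists K : nat, forall n, exists F : {set {set 'I_n}},
    [/\ nat_intersecting a b F, forall A, A \in F -> #|A| <= K
      & (Ctheta R a b * n%:R - K%:R <= #|F|%:R)%R].
Proof.
move=> a0 ab co abP.
suff [c [s [t [s0 tok CE]]]] : exists c s t, [/\ 0 < s, template_ok a b c s t
    & (Ctheta R a b = (size t)%:R / s%:R)%R].
  (* The part [c + s] bounds the set sizes; the rest covers the loss from the core and the
     incomplete last block, at most [c + s] points at density [size t / s]. *)
  exists (size t + size t * c + (c + s)) => n.
  have [F [FI Fc cF]] := @template_family a b c s n t ab tok.
  exists F; split=> // [A /Fc|]; first by lia.
  have s0' : (0 < s%:R :> R)%R by rewrite ltr0n.
  have s1 : (1 <= s%:R :> R)%R by rewrite ler1n.
  have : n <= (n - c) %/ s * s + s + c by have := ltn_ceil (n - c) s0; nia.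
  rewrite -(ler_nat R) cF CE !natrD !natrM.
  move: ((n - c) %/ s)%:R%R (size t)%:R%R (ler0n R (size t)) (ler0n R c) => m u u0 c0.
  move: n%:R%R c%:R%R s%:R%R s0' s1 c0 => N C S S0 S1 C0 NE.
  rewrite lerBlDr mulrAC ler_pdivrMr //.
  apply: Order.POrderTheory.le_trans (_ : u * (m * S + S + C) <= _)%R.
    by rewrite ler_wpM2l.
  have h1 : (0 <= u * C * (S - 1))%R by rewrite !mulr_ge0 // subr_ge0.
  have h2 : (0 <= C * S)%R by rewrite mulr_ge0 // ltW.
  have h3 : (0 <= S * S)%R by rewrite mulr_ge0 // ltW.
  by nra.
have one d : coprime a (d * a) -> a = 1.
  by move=> /eqP; rewrite gcdnMl.
case: abP => [b3|b2].
  have a1 : a = 1 by apply: (one 3); rewrite -b3.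
  have {b3} -> : b = 3 by rewrite b3 a1.
  (* Core parts of 1, 2, 3 points go with petals of 2, 4, 6 points: 12 pairs, 6 rows and 4 columns
     on 24 points, of density [22 / 24 = (1 + 1/2 + 1/3) / 2]. *)
  rewrite a1; exists 3, 24, ([seq (1, [:: i.*2; i.*2.+1]) | i <- iota 0 12] ++
    [seq (2, [:: r; 6 + r; 12 + r; 18 + r]) | r <- iota 0 6] ++
    [seq (3, iota (6 * k) 6) | k <- iota 0 4]).
  split=> //; rewrite /Ctheta /= 3?big_nat_recr //= big_geq //= ?divn1 ?invr1.
  by field.
move: b2; rewrite leq_eqVlt => /orP[/eqP b2|b2].
  have a1 : a = 1 by apply: (one 2); rewrite -b2.
  have {b2} -> : b = 2 by rewrite b2 a1.
  (* Two singletons and their union as petals: density [3 / 2 = 1 + 1/2]. *)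
  rewrite a1; exists 2, 2, [:: (1, [:: 0]); (1, [:: 1]); (2, [:: 0; 1])].
  split=> //; rewrite /Ctheta /= 2?big_nat_recr //= big_geq //= ?divn1 ?invr1.
  by field.
(* Here [b %/ a = 1], and a single sunflower of sets of size [b] suffices. *)
exists a, (b - a), [:: (a, iota 0 (b - a))]; split; first by lia.
  rewrite /template_ok /= leqnn iota_uniq a0 !andbT /meets_ok /= size_iota.
  rewrite minnn subnKC 1?ltnW // addn0 mulnC eqxx /= !andbT.
  by apply/allP => x; rewrite mem_iota.
have q1 : b %/ a = 1 by apply/eqP; rewrite eqn_leq divn_gt0 // (ltnW ab) andbT -ltnS ltn_divLR.
by rewrite /Ctheta q1 big_nat1 invr1 mulr1 /= natrB ?mul1r // ltnW.
Qed.

Local Open Scope ring_scope.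

(** * Harmonic sums over multiplicative windows *)

(** The block has [m] terms, each at most [1 / (m * r)]. *)
Lemma harmonic_block (R : realFieldType) (m r : nat) : (0 < m)%N -> (0 < r)%N ->
  \sum_(m * r <= i < m * r.+1) i%:R^-1 <= r%:R^-1 :> R.
Proof.
move=> m0 r0; apply: le_trans (_ : \sum_(m * r <= i < m * r.+1) (m * r)%:R^-1 <= _).
  rewrite big_nat_cond [leRHS]big_nat_cond; apply: ler_sum => i /andP[/andP[mi _] _].
  by rewrite lef_pV2 ?posrE ?ltr0n ?ler_nat //; nia.
rewrite sumr_const_nat mulnS addnK -(mulr_natr (m * r)%:R^-1) natrM invfM.
rewrite mulrAC mulVf ?mul1r //; by rewrite pnatr_eq0 -lt0n.
Qed.

(** The value at [m = 2] is [1/2 + 1/3], and the sum does not increase with [m]: the term [1 / m] is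
    traded for [1 / (2 m) + 1 / (2 m + 1)]. *)
Lemma harmonic_first_block (R : realFieldType) (m : nat) : (1 < m)%N ->
  \sum_(m <= i < m.*2) i%:R^-1 <= 5 / 6 :> R.
Proof.
elim: m => // -[//|[_ _|m IH _]].
  by rewrite big_nat_recl // big_nat1; lra.
apply: le_trans (IH isT).
rewrite [leRHS]big_ltn; last by lia.
rewrite (doubleS m.+2) [leLHS]big_nat_recr /=; last by lia.
rewrite [X in X + _ <= _]big_nat_recr /=; last by lia.
set S := \sum_(_ <= i < _) _.
rewrite -[leLHS]addrA [leRHS]addrC lerD2l.
have m0 : 0 < m.+2%:R :> R by rewrite ltr0n.
have E1 : m.+2.*2%:R = 2 * m.+2%:R :> R by rewrite -mul2n natrM.
have E2 : m.+2.*2.+1%:R = 2 * m.+2%:R + 1 :> R by rewrite -natr1 E1.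
rewrite E1 E2; apply: le_trans (_ : (2 * m.+2%:R)^-1 + (2 * m.+2%:R)^-1 <= _).
  by rewrite lerD2r || rewrite lerD2l; rewrite lef_pV2 ?posrE; lra.
by rewrite le_eqVlt; apply/orP; left; apply/eqP; field; lra.
Qed.

Lemma harmonic_window (R : realFieldType) (q m : nat) : (0 < m)%N ->
  \sum_(m <= i < m * q.+1) i%:R^-1 <= \sum_(1 <= i < q.+1) i%:R^-1 :> R.
Proof.
move=> m0; elim: q => [|q IH]; first by rewrite muln1 !big_geq.
rewrite [leRHS]big_nat_recr //= (big_cat_nat _ (n := m * q.+1)) /=; [|nia..].
by rewrite lerD ?harmonic_block.
Qed.

(** Same block decomposition as in [harmonic_window], with the first block bounded by [5 / 6]
    instead of 1. *)
Lemma harmonic_window_gap (R : realFieldType) (q m : nat) : (1 < m)%N -> (0 < q)%N ->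
  \sum_(m <= i < m * q.+1) i%:R^-1 <= \sum_(1 <= i < q.+1) i%:R^-1 - 1 / 6 :> R.
Proof.
move=> m1; case: q => // q _; elim: q => [|q IH].
  rewrite muln2 big_nat1; apply: le_trans (harmonic_first_block _ m1) _; lra.
rewrite [in leRHS]big_nat_recr //= (big_cat_nat _ (n := m * q.+2)) /=; [|nia..].
by rewrite addrAC lerD ?harmonic_block // ltnW.
Qed.

Lemma ler_sum_subseq (R : numDomainType) (s t : seq nat) (g : nat -> R) :
  (forall i, 0 <= g i) -> uniq s -> uniq t -> {subset s <= t} ->
  \sum_(i <- s) g i <= \sum_(i <- t) g i.
Proof.
move=> g0 us ut st; rewrite [leRHS](bigID (mem s)) /= -[X in _ <= X + _]big_filter.
rewrite [X in _ <= X + _](perm_big s) ?lerDl ?sumr_ge0 //.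
apply: uniq_perm; rewrite ?filter_uniq // => i; rewrite mem_filter /=.
by case: (boolP (i \in s)) => //= /st ->.
Qed.

(* If the least element m of s exceeds 1, the first of the blocks
   [mr, m(r+1)), r = 1 .. q, covering s contributes at most 5/6 instead of 1. *)
Lemma sum_inv_clique (R : realFieldType) (a b : nat) (s : seq nat) :
  (0 < a)%N -> (a < b)%N -> uniq s -> 0%N \notin s ->
  (forall i j, i \in s -> j \in s -> (a * j <= b * i)%N) ->
  \sum_(i <- s) i%:R^-1 <= \sum_(1 <= i < (b %/ a).+1) i%:R^-1
    - (~~ all (mem s) (iota 1 (b %/ a)))%:R / (6 * (b %/ a)%:R) :> R.
Proof.
move=> a0 ab us s0 sP; have bq := ltn_ceil b a0.
have : (0 < b %/ a)%N by rewrite divn_gt0 // ltnW.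
move: (b %/ a)%N bq => q bq q0.
have q1 : 1 <= q%:R :> R by rewrite ler1n.
(* The loss must be affordable in every deficient case: [1 / 6] is saved when the least index
   exceeds 1, and at least [1 / q] when [s] is empty or misses some [r <= q]. *)
set d := _ / _; have d6 : d <= 1 / 6 /\ d <= q%:R^-1.
  rewrite /d; case: (~~ _); rewrite ?mul0r ?mul1r; split; rewrite ?invr_ge0; try lra.
  - by rewrite lef_pV2 ?posrE; lra.
  - by rewrite lef_pV2 ?posrE; lra.
have inv0 (i : nat) : 0 <= i%:R^-1 :> R by rewrite invr_ge0.
case: (posnP (size s)) => [/size0nil sE|sn].
  have : q%:R^-1 <= \sum_(1 <= i < q.+1) i%:R^-1 :> R.
    by rewrite big_nat_recr //= lerDr sumr_ge0.
  by rewrite {1}sE big_nil; lra.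
have exs : exists m, m \in s by case: (s) sn => // x; exists x; rewrite mem_head.
have [m ms mmin] := ex_minnP exs.
have m0 : (0 < m)%N by rewrite lt0n; apply: contraNneq s0 => <-.
(* From [a * j <= b * m] and [b < q.+1 * a]. *)
have sub : {subset s <= index_iota m (m * q.+1)}.
  by move=> j js; rewrite mem_index_iota mmin //=; have := sP _ _ ms js; nia.
have [m1|m1] := ltnP 1 m.
  apply: le_trans (ler_sum_subseq inv0 us (iota_uniq _ _) sub) _.
  by apply: le_trans (harmonic_window_gap R m1 q0) _; lra.
have {m0 m1 sub} sub : {subset s <= index_iota 1 q.+1}.
  by have mE : m = 1%N by [lia]; move: sub; rewrite mE mul1n.
have [al|/allPn[r rq rs]] := boolP (all (mem s) (iota 1 q)).
  by rewrite /d al mul0r subr0; apply: ler_sum_subseq => //; exact: iota_uniq.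
have rq' : r \in index_iota 1 q.+1 by rewrite /index_iota subSS subn0.
rewrite [X in _ <= X - _](perm_big (r :: rem r (index_iota 1 q.+1))) ?perm_to_rem //= big_cons.
have : q%:R^-1 <= r%:R^-1 :> R.
  by move: rq'; rewrite mem_index_iota => ?; rewrite lef_pV2 ?posrE ?ltr0n ?ler_nat //; lia.
suff : \sum_(i <- s) i%:R^-1 <= \sum_(i <- rem r (index_iota 1 q.+1)) i%:R^-1 :> R by lra.
apply: ler_sum_subseq => //; first by rewrite rem_uniq ?iota_uniq.
move=> i si; rewrite mem_rem_uniq ?iota_uniq // inE sub // andbT.
by apply: contraNneq rs => <-.
Qed.

(** * Weighting the petals of a bouquet *)

(** The exceptional points of the equality case; [petal_count] charges a fixed loss to each of
    them. *)
Definition unsaturated (a b n : nat) (F : {set {set 'I_n}}) : {set 'I_n} :=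
  [set x | ~~ all (fun i => [exists A in F, (#|A| == i * b)%N && (x \in A)])
              (iota 1 (b %/ a))].

(* Each petal of size s spreads weight 1/s over its points. Two petals through
   x, of sizes i(b-a) and j(b-a) with i < j, come from sets meeting in more
   than the smaller core, hence in ja points, so ja <= ib. *)
Lemma petal_count (R : realFieldType) (a b n : nat) (F : {set {set 'I_n}}) :
  (0 < a)%N -> (a < b)%N -> nat_intersecting a b F ->
  (forall A, A \in F -> [/\ 0 < #|A|, b %| #|A|,
     b * #|core (level F #|A|)| = a * #|A| & core (level F #|A|) \subset A])%N ->
  (forall A B, A \in F -> B \in F -> (#|A| <= #|B|)%N ->
     core (level F #|A|) \subset core (level F #|B|)) ->
  (b%:R - a%:R) * #|F|%:R <=
    n%:R * \sum_(1 <= i < (b %/ a).+1) i%:R^-1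
      - #|unsaturated a b F|%:R / (6 * (b %/ a)%:R) :> R.
Proof.
move=> a0 ab [_ FI] FP Fc.
have b0 : (0 < b)%N by lia.
set H := \sum_(_ <= _ < _) _; set q := (b %/ a)%N.
pose petal (A : {set 'I_n}) := A :\: core (level F #|A|).
(* A set of size [i * b] has a petal of [i * (b - a)] points, each receiving [b / #|A| = 1 / i]. *)
have cpetal A : A \in F -> (b%:R - a%:R) = \sum_(x in petal A) b%:R / #|A|%:R :> R.
  move=> AF; have [A0 bA cA sA] := FP _ AF.
  rewrite sumr_const -[RHS]mulr_natr cardsD (setIidPr sA) natrB ?subset_leq_card //.
  have A0' : #|A|%:R != 0 :> R by rewrite pnatr_eq0 -lt0n.
  have E : b%:R * #|core (level F #|A|)|%:R = a%:R * #|A|%:R :> R by rewrite -!natrM cA.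
  by apply: (mulIf A0'); rewrite mulrBl -E; field.
have -> : (b%:R - a%:R) * #|F|%:R =
    \sum_x \sum_(A in F | x \in petal A) b%:R / #|A|%:R :> R.
  rewrite mulr_natr -sumr_const (eq_bigr _ cpetal).
  rewrite (exchange_big_dep predT) //=.
have -> : n%:R * H = \sum_(x : 'I_n) H by rewrite sumr_const card_ord mulr_natl.
have -> : #|unsaturated a b F|%:R / (6 * q%:R) =
    \sum_(x : 'I_n) (x \in unsaturated a b F)%:R / (6 * q%:R) :> R.
  by rewrite -mulr_suml -sum1_card natr_sum big_mkcond; congr (_ * _);
    apply: eq_bigr => x _; case: (x \in _).
rewrite -sumrB; apply: ler_sum => x _.
pose S := [set A in F | x \in petal A].
have SP A : A \in S -> [/\ A \in F, x \in A & x \notin core (level F #|A|)].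
  by rewrite inE in_setD => /and3P[].
have Smeet A B : A \in S -> B \in S -> (#|A| <= #|B|)%N -> A != B ->
    (a * #|B| <= b * #|A|)%N /\ #|A| != #|B|.
  move=> /SP[AF xA nxA] /SP[BF xB nxB] le AB.
  have [A0 bA cA sA] := FP _ AF; have [B0 bB cB sB] := FP _ BF.
  have sub : core (level F #|A|) \subset A :&: B.
    by rewrite subsetI sA (subset_trans (Fc _ _ AF BF le)).
  have pr : core (level F #|A|) \proper A :&: B.
    apply/properP; split=> //; exists x => //; by rewrite inE xA.
  have ltc := proper_card pr.
  have leA : (#|A :&: B| <= #|A|)%N by apply/subset_leq_card/subsetIl.
  (* The other alternative would make the intersection as small as the core of [A], but it also
     contains [x]. *)
  have aB : (b * #|A :&: B|)%N = (a * #|B|)%N.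
    case: (FI _ _ AF BF AB) => // E.
    by move: ltc; rewrite -(ltn_pmul2l b0) cA E ltnn.
  split; first by rewrite -aB leq_mul2l leA orbT.
  apply: contraTneq ltc => AeB; rewrite -leqNgt.
  by rewrite -(leq_pmul2l b0) aB cA AeB.
pose s := map (fun A : {set 'I_n} => (#|A| %/ b)%N) (enum S).
have us : uniq s.
  rewrite map_inj_in_uniq ?enum_uniq // => A B; rewrite !mem_enum => AS BS E.
  apply/eqP/negPn/negP => AB.
  have [AF _ _] := SP _ AS; have [BF _ _] := SP _ BS.
  have [_ bA _ _] := FP _ AF; have [_ bB _ _] := FP _ BF.
  have cAB : #|A| = #|B| by rewrite -(divnK bA) -(divnK bB) E.
  by have [] := Smeet _ _ AS BS (eq_leq cAB) AB; rewrite cAB eqxx.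
have sP i : i \in s -> exists2 A, A \in S & #|A| = (i * b)%N.
  case/mapP => A; rewrite mem_enum => AS ->; exists A => //.
  by have [AF _ _] := SP _ AS; have [_ bA _ _] := FP _ AF; rewrite divnK.
have s0 : 0%N \notin s.
  apply/negP => /sP[A /SP[AF _ _] c0]; have [A0 _ _ _] := FP _ AF.
  by move: A0; rewrite c0.
have scl i j : i \in s -> j \in s -> (a * j <= b * i)%N.
  move=> /sP[A AS cA] /sP[B BS cB].
  (* When [j < i] the inequality is immediate from [a < b]. *)
  have [lt|le] := ltnP #|B| #|A|; first by nia.
  case: (eqVneq A B) => [AB|AB].
    by have : (i * b = j * b)%N by [rewrite -cA -cB AB]; nia.
  by have [] := Smeet _ _ AS BS le AB; rewrite cA cB; nia.
have -> : \sum_(A in F | x \in petal A) b%:R / #|A|%:R = \sum_(i <- s) i%:R^-1 :> R.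
  rewrite big_map big_enum /= [RHS](eq_bigl (fun A => (A \in F) && (x \in petal A))).
    apply: eq_bigr => A /andP[AF _]; have [_ bA _ _] := FP _ AF.
    rewrite -{1}(divnK bA) natrM invfM mulrCA mulfV ?mulr1 //.
    by rewrite pnatr_eq0 -lt0n.
  by move=> A; rewrite inE.
apply: le_trans (sum_inv_clique R a0 ab us s0 scl) _; rewrite -/H -/q lerD2l lerN2.
apply: ler_wpM2r; first by rewrite invr_ge0 mulr_ge0.
(* The indices in [s] come from petals through [x], whereas [unsaturated] lets cores cover [x] too,
   so the indicators compare in one direction only. *)
rewrite ler_nat inE.
case: (boolP (all (mem s) _)) => [al|_]; last by case: (~~ _).
rewrite (_ : all _ _) //; apply/allP => i /(allP al) /sP[A AS cA].
by have [AF xA _] := SP _ AS; apply/exists_inP; exists A; rewrite ?cA ?eqxx.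
Qed.

(** * Bounds for real [w] at a fixed [n] *)

Lemma intersecting_nat (a b n : nat) (theta : rat) (F : {set {set 'I_n}}) :
  (0 < b)%N -> theta = a%:R / b%:R ->
  intersecting theta F <-> nat_intersecting a b F.
Proof.
move=> b0 ->; have b0' : b%:R != 0 :> rat by rewrite pnatr_eq0 -lt0n.
have E (x y : nat) : x%:R = a%:R / b%:R * y%:R :> rat <-> (b * x = a * y)%N.
  split=> [H|H].
    apply/eqP; rewrite -(eqr_nat rat) !natrM H; apply/eqP; by field.
  apply: (mulfI b0'); rewrite -natrM H natrM; by field.
split=> [[F0 FI]|[F0 FI]]; split.
- by apply/negP => /F0; rewrite eqxx.
- by move=> A B AF BF AB; rewrite -!E; exact: FI.
- by move=> A AF; apply: contraNneq F0 => <-.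
- by move=> A B AF BF AB; rewrite !E; exact: FI.
Qed.

Lemma bouquet_bound (R : realFieldType) (a b n : nat) (w : R) (F : {set {set 'I_n}}) :
  (0 < a)%N -> (a < b)%N -> coprime a b -> nat_intersecting a b F ->
  0 < w -> bounded_by w F ->
  exists Fs : {set {set 'I_n}}, [/\ bouquet Fs, Fs \subset F,
    #|F :\: Fs|%:R <= 1 + (w + 1) * (2 * w * w + 1)
    & #|Fs|%:R <= Ctheta R a b * n%:R
        - #|unsaturated a b Fs|%:R / (6 * (b %/ a)%:R * (b%:R - a%:R))].
Proof.
move=> a0 ab co FI w0 Fw.
(* The actual maximal size is an integer stand-in for [w]; it is 0 for the empty family, where
   [0 < w] gives [W <= w]. *)
pose W := (\max_(A in F) #|A|)%N.
have FW A : A \in F -> (#|A| <= W)%N by move=> AF; exact: leq_bigmax_cond.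
have Ww : W%:R <= w.
  rewrite /W; elim/big_ind: _ => [|x y xw yw|A /Fw //]; first exact: ltW.
  by case: (leqP x y) => xy; rewrite ?(maxn_idPr xy) ?(maxn_idPl (ltnW xy)).
have [Fs [Fb FsF FsP Fsc Fsd]] := bouquet_extraction a0 ab co FI FW.
have FsI : nat_intersecting a b Fs.
  split; first by apply: contra FI.1; exact/subsetP.
  by move=> A B /(subsetP FsF) AF /(subsetP FsF) BF; exact: FI.2.
exists Fs; split=> //.
  apply: le_trans (_ : (1 + W.+1 * (2 * W * W + 1))%:R <= _); first by rewrite ler_nat.
  have W0 : 0 <= W%:R :> R by [].
  rewrite -[W.+1]addn1 !(natrD, natrM); move: Ww W0; move: W%:R => V Vw V0.
  rewrite lerD2l ler_pM ?lerD2r ?addr_ge0 ?mulr_ge0 //.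
  by rewrite ler_pM ?mulr_ge0 // ler_pM.
have := petal_count R a0 ab FsI FsP Fsc.
have ba : 0 < b%:R - a%:R :> R by rewrite subr_gt0 ltr_nat.
rewrite mulrC -ler_pdivlMr // => /le_trans; apply.
have q0 : (b %/ a)%:R != 0 :> R by rewrite pnatr_eq0 -lt0n divn_gt0 // ltnW.
rewrite /Ctheta le_eqVlt; apply/orP; left; apply/eqP; field.
by rewrite q0 gt_eqF.
Qed.

From mathcomp Require Import all_classical all_reals all_analysis.
Import numFieldNormedType.Exports.
Local Open Scope classical_set_scope.

(** * Asymptotics *)

Lemma cube_root_nat (R : realType) (n : nat) : (n%:R `^ 3^-1) ^+ 3 = n%:R :> R.
Proof. by rewrite -powR_mulrn ?powR_ge0 // -powRrM mulVf ?powRr1. Qed.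

(** Serves both the lower-order terms in [cubic_littleo] and the constant [w] of the extremal
    families. *)
Lemma const_littleo_cube_root (R : realType) (c : R) :
  (fun=> c) =o_\oo (fun n => n%:R `^ 3^-1 : R).
Proof.
apply/eqoP => e e0; have := nbhs_infty_ger ((`|c| / e) ^+ 3).
apply: filterS => n H.
rewrite (ger0_norm (powR_ge0 _ _)) mulrC -ler_pdivrMr //.
rewrite -(@ler_pXn2r _ 3) ?nnegrE ?powR_ge0 ?divr_ge0 ?(ltW e0) //.
by rewrite cube_root_nat.
Qed.

Lemma cubic_littleo (R : realType) (w : nat -> R) :
  (forall n, 0 < w n) -> w =o_\oo (fun n => n%:R `^ 3^-1) ->
  (fun n => 1 + (w n + 1) * (2 * w n * w n + 1)) =o_\oo (fun n => n%:R : R).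
Proof.
move=> w0 wo; apply/eqoP => e e0.
(* Expanded, the expression is [2 + v + 2 v^2 + 2 v^3], with coefficient sum 7. Once [v] and 1 are
   at most [x = d * g], it is at most [7 x^3], and [d <= 1] gives [7 d^3 <= 7 d <= e]. *)
pose d : R := Num.min 1 (e / 7).
have d0 : 0 < d by rewrite lt_min ltr01 divr_gt0.
have /eqoP/(_ d d0) A1 := wo.
have /eqoP/(_ d d0) A2 := @const_littleo_cube_root R 1.
apply: filterS2 A1 A2 => n /=.
rewrite !(ger0_norm (powR_ge0 _ _)) (ger0_norm (ltW (w0 n))) normr1 normr_nat.
have W0 := w0 n; move: (w n) W0 => v v0 vd gd.
rewrite ger0_norm; last by rewrite addr_ge0 // mulr_ge0 // addr_ge0 ?mulr_ge0 // ltW.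
have -> : n%:R = (n%:R `^ 3^-1) ^+ 3 :> R by rewrite cube_root_nat.
move: (powR_ge0 n%:R 3^-1 : 0 <= _ :> R); move: (n%:R `^ 3^-1) vd gd => g vd gd g0.
apply: (@le_trans _ _ (7 * (d * g) ^+ 3)).
  move: (d * g) vd gd => x vx x1; have x0 : 0 <= x by lra.
  have v2 : v * v <= x * x by rewrite ler_pM // ltW.
  have v3 : v * v * v <= x * x * x by rewrite ler_pM ?mulr_ge0 // ltW.
  have x2 : x * x <= x * x * x by rewrite ler_peMr ?mulr_ge0.
  have x12 : x <= x * x by rewrite ler_peMr.
  have -> : x ^+ 3 = x * x * x by rewrite !exprS expr0 mulr1 mulrA.
  have -> : 1 + (v + 1) * (2 * v * v + 1) = 2 + v + 2 * (v * v) + 2 * (v * v * v) by ring.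
  by lra.
rewrite exprMn mulrA ler_wpM2r ?exprn_ge0 //.
have d1 : d <= 1 by rewrite ge_min lexx.
have de : d <= e / 7 by rewrite ge_min lexx orbT.
have : d ^+ 3 <= d by rewrite exprSr ler_piMl ?(ltW d0) // exprn_ile1 // ltW.
by lra.
Qed.

Lemma littleo_le (R : realType) (u v : nat -> R) (f : nat -> R) :
  (forall n, 0 <= u n <= v n) -> v =o_\oo f -> u =o_\oo f.
Proof.
move=> uv /eqoP vo; apply/eqoP => e /vo; apply: filterS => n.
apply: le_trans; have /andP[u0 le] := uv n.
by rewrite !ger0_norm // (le_trans u0).
Qed.

Lemma littleo_ratio_cvg0 (R : realType) (u : nat -> R) :
  u =o_\oo (fun n => n%:R : R) -> u n / n%:R @[n --> \oo] --> (0 : R).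
Proof.
move=> /eqoP uo; apply/cvgr0Pnorm_le => e e0.
have := uo _ e0; apply: filterS => n; rewrite normr_nat => H.
rewrite normrM normfV normr_nat; case: (posnP n) => [->|n0].
  by rewrite invr0 mulr0 ltW.
by rewrite ler_pdivrMr // ltr0n.
Qed.

Lemma cvg0_mul_littleo (R : realType) (e : nat -> R) :
  e n @[n --> \oo] --> (0 : R) -> (fun n => e n * n%:R) =o_\oo (fun n => n%:R : R).
Proof.
move=> /cvgr0Pnorm_le eo; apply/eqoP => d /eo; apply: filterS => n.
by rewrite normrM => H; rewrite ler_wpM2r.
Qed.

(** Common source of the upper bound and of the equality case: the last inequality retains both the
    discarded sets and the loss at unsaturated points. *)
Lemma asymptotic_bouquet (R : realType) (a b : nat) (w : nat -> R)
    (F : forall n, {set {set 'I_n}}) :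
  (0 < a)%N -> (a < b)%N -> coprime a b -> (forall n, 0 < w n) ->
  w =o_\oo (fun n => n%:R `^ 3^-1) ->
  (forall n, bounded_by (w n) (F n) /\ nat_intersecting a b (F n)) ->
  exists Fs : forall n, {set {set 'I_n}},
    [/\ forall n, bouquet (Fs n) /\ Fs n \subset F n,
        (fun n => #|F n :\: Fs n|%:R : R) =o_\oo (fun n => n%:R : R)
      & forall n, #|F n|%:R <= Ctheta R a b * n%:R + #|F n :\: Fs n|%:R
          - #|unsaturated a b (Fs n)|%:R / (6 * (b %/ a)%:R * (b%:R - a%:R)) :> R].
Proof.
move=> a0 ab co w0 wo FP.
have H n := bouquet_bound a0 ab co (FP n).2 (w0 n) (FP n).1.
exists (fun n => sval (cid (H n))); split.
- by move=> n; case: (cid (H n)) => Fs [? ? ? ?].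
- apply: littleo_le (cubic_littleo w0 wo) => n.
  by case: (cid (H n)) => Fs [? ? ? ?]; rewrite ler0n.
move=> n; case: (cid (H n)) => Fs [_ FsF _ le] /=.
have -> : #|F n|%:R = #|Fs|%:R + #|F n :\: Fs|%:R :> R.
  by rewrite -natrD cardsD (finset.setIidPr FsF) subnKC // subset_leq_card.
by rewrite addrAC lerD2r.
Qed.

Theorem theorem1p7 (R : realType) (a b : nat) (theta : rat)
    (ha : (1 <= a)%N) (hab : (a < b)%N) (hco : coprime a b)
    (htheta : theta = a%:R / b%:R) :
  (forall (w : nat -> R) (F : forall n, {set {set 'I_n}}),
     (forall n, 0 < w n) ->
     w =o_\oo (fun n => n%:R `^ 3^-1) ->
     (forall n, bounded_by (w n) (F n) /\ intersecting theta (F n)) ->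
     exists2 e : nat -> R, e n @[n --> \oo] --> (0 : R) &
       forall n, #|F n|%:R <= (Ctheta R a b + e n) * n%:R)
  /\
  (theta = 1 / 3 \/ 1 / 2 <= theta < 1 ->
   exists (w : nat -> R) (F : forall n, {set {set 'I_n}}),
     [/\ forall n, 0 < w n,
         w =o_\oo (fun n => n%:R `^ 3^-1),
         forall n, bounded_by (w n) (F n) /\ intersecting theta (F n)
       & exists2 e : nat -> R, e n @[n --> \oo] --> (0 : R) &
           forall n, (Ctheta R a b - e n) * n%:R <= #|F n|%:R])
  /\
  (forall (w : nat -> R) (F : forall n, {set {set 'I_n}}),
     (forall n, 0 < w n) ->
     w =o_\oo (fun n => n%:R `^ 3^-1) ->
     (forall n, bounded_by (w n) (F n) /\ intersecting theta (F n)) ->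
     (exists2 e : nat -> R, e n @[n --> \oo] --> (0 : R) &
        forall n, #|F n|%:R = (Ctheta R a b + e n) * n%:R) ->
     exists Fs : forall n, {set {set 'I_n}},
       [/\ forall n, bouquet (Fs n) /\ Fs n \subset F n,
           (fun n => #|F n :\: Fs n|%:R : R) =o_\oo (fun n => n%:R : R)
         & exists2 X : forall n, {set 'I_n},
             (fun n => #|X n|%:R : R) =o_\oo (fun n => n%:R : R) &
             forall n (x : 'I_n), x \notin X n ->
             forall i, (1 <= i <= b %/ a)%N ->
             exists A, [/\ A \in Fs n, #|A| = (i * b)%N & x \in A]]).
Proof.
have b0 : (0 < b)%N by exact: leq_ltn_trans hab.
have natP n (F : {set {set 'I_n}}) := intersecting_nat F b0 htheta.
have ba : 0 < b%:R - a%:R :> R by rewrite subr_gt0 ltr_nat.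
have q0 : (0 < b %/ a)%N by rewrite divn_gt0 // ltnW.
pose M : R := 6 * (b %/ a)%:R * (b%:R - a%:R).
have M0 : 0 < M by rewrite !mulr_gt0 ?ltr0n.
split; [|split].
- move=> w F w0 wo FP.
  have [|Fs [Fsb Fso Fsle]] := asymptotic_bouquet ha hab hco w0 wo (F := F).
    by move=> n; have [? /natP] := FP n.
  exists (fun n => #|F n :\: Fs n|%:R / n%:R); first exact: littleo_ratio_cvg0.
  (* The error term divides by [n]; for [n = 0] the family is empty, since its members are
     nonempty. *)
  case=> [|n].
    rewrite mulr0 eq_card0 // => A; apply/negP => /((FP 0%N).2.1).
    by case/finset.set0Pn => -[].
  apply: le_trans (Fsle n.+1) _; rewrite [leRHS]mulrDl divfK ?pnatr_eq0 //.
  by rewrite gerDl oppr_le0 divr_ge0 // ltW.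
- move=> thetaP.
  have ab23 : b = (3 * a)%N \/ (b <= 2 * a)%N.
    have b0' : 0 < b%:R :> rat by rewrite ltr0n.
    case: thetaP => [E|/andP[E _]]; [left|right].
      apply/eqP; rewrite -(eqr_nat rat) natrM; apply/eqP.
      have : theta * b%:R = a%:R by rewrite htheta divfK // gt_eqF.
      by rewrite E; lra.
    rewrite -(ler_nat rat) natrM.
    have : 1 / 2 * b%:R <= theta * b%:R by rewrite ler_pM2r.
    by rewrite htheta divfK ?gt_eqF //; lra.
  have [K KP] := extremal_families R ha hab hco ab23.
  (* Adding 1 keeps [w] positive when [K = 0]. *)
  exists (fun=> K%:R + 1), (fun n => sval (cid (KP n))); split.
  + by move=> n; rewrite ltr_wpDl.
  + exact: const_littleo_cube_root.
  + move=> n; case: (cid (KP n)) => F [FI FK _] /=; split; last exact/natP.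
    by move=> A /FK AK; rewrite natr1 ler_nat leqW.
  (* As [harmonic n] is [1 / (n + 1)], the factor 2 ensures that the error times [n] is at least [K]
     for [n >= 1]. *)
  exists (fun n => (2 * K%:R) * harmonic n).
    by rewrite -(mulr0 (2 * K%:R)); apply: cvgMr; exact: cvg_harmonic.
  case=> [|n]; first by rewrite mulr0.
  case: (cid (KP n.+1)) => F [_ _] /=; apply: le_trans.
  rewrite mulrBl lerD2l lerN2 /harmonic mulrAC ler_pdivlMr ?ltr0n //.
  have K0 : 0 <= K%:R :> R by [].
  by rewrite -[2 * _]mulrC -mulrA ler_wpM2l // -natrM ler_nat; lia.
move=> w F w0 wo FP [e e0 Fe].
have [|Fs [Fsb Fso Fsle]] := asymptotic_bouquet ha hab hco w0 wo (F := F).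
  by move=> n; have [? /natP] := FP n.
exists Fs; split=> //; exists (fun n => unsaturated a b (Fs n)).
  have eo := cvg0_mul_littleo e0.
  (* With equality the terms [Ctheta * n] cancel, so the unsaturated points number at most [M] times
     the discarded sets minus [e n * n]. Each of these two contributions gets half of [d / M]. *)
  apply/eqoP => d d0; have d' : 0 < d / (2 * M) by rewrite divr_gt0 // mulr_gt0.
  move/eqoP: eo => /(_ _ d') e1; move/eqoP: Fso => /(_ _ d').
  apply: filterS2 e1 => n /=; rewrite !normr_nat => e1 D1.
  have := Fsle n; rewrite Fe -/M mulrDl => le.
  have {}e1 : - (e n * n%:R) <= d / (2 * M) * n%:R.
    by rewrite (le_trans _ e1) // ler_normr lexx orbT.
  have dE : d / M * n%:R = d / (2 * M) * n%:R + d / (2 * M) * n%:R by field; rewrite gt_eqF.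
  have {}le : #|unsaturated a b (Fs n)|%:R / M <= d / M * n%:R.
    by rewrite dE; move: le e1 D1; move: (d / (2 * M) * n%:R) (_ / M) => y z; lra.
  by rewrite -(ler_pM2r (x := M^-1)) ?invr_gt0 // mulrAC.
move=> n x; rewrite inE negbK => /allP xP i /andP[i1 iq].
have /exists_inP[A AF /andP[/eqP cA xA]] := xP i ltac:(by rewrite mem_iota i1 add1n ltnS).
by exists A.
Qed.
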